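(* Fix a vertex and suppose all resource extension functions are non-decreasing and the monotone resource $\rho$ strictly increases along every edge. Suppose the labels of the vertex are created in non-decreasing $\leq^{lex}$ order, which the pull schedule guarantees: the vertex's forward buckets are processed in increasing $\rho$, and the batch of labels pulled into one bucket is inserted in $\leq^{lex}$ order (this per-batch sort is required: without it a newly created label could be dominated by another label of the same batch that is not yet stored, and testing only against the already-stored labels would be unsound). Then a label that is not dominated when created is never dominated by a label created later. Consequently it suffices to test each new label against the already-stored labels of the vertex, and a stored label is never removed.
   Context: Setting: the resource constrained shortest path problem on a directed graph with a source and a target, finite resource set $R=\{\rho,r_2,\dots,r_{|R|}\}$, and, for each resource, a resource extension function giving the evolution of that resource across an edge; ''non-decreasing'' means monotone non-decreasing in the incoming resource state. $\rho$ is the designated monotone resource. A label $L$ represents a partial path ending at a vertex $v(L)$, with accumulated cost $cost(L)$ and accumulation $r(L)$ of each resource $r\in R$. Dominance: let $\mathcal{E}(L)$ be the set of valid extensions of $L$, i.e. the paths from $v(L)$ to the target that extend $L$ feasibly, and let $cost(L+\epsilon)$ be the cost of $L$ extended by $\epsilon\in\mathcal{E}(L)$. For labels $L_1,L_2$ at the same vertex, $L_1$ dominates $L_2$ if $\mathcal{E}(L_2)\subseteq\mathcal{E}(L_1)$ and $cost(L_1+\epsilon)\le cost(L_2+\epsilon)$ for all $\epsilon\in\mathcal{E}(L_2)$. As not all extensions of a label are known, the algorithm determines dominance by a sufficient condition: $v(L_1)=v(L_2)$, $cost(L_1)\le cost(L_2)$, and $r(L_1)\le r(L_2)$ for all $r\in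 R$ (including $\rho$). Lexicographic order: for labels at the same vertex, $L_1\leq^{lex}L_2$ means that $(\rho(L_1),cost(L_1),r_2(L_1),\dots)$ precedes or equals $(\rho(L_2),cost(L_2),r_2(L_2),\dots)$ lexicographically, i.e. first by $\rho$, then by cost, then by the remaining resources in a fixed order. Two labels that agree on every coordinate are duplicates (mutually dominating), one of which is discarded on creation. Pull schedule: the range of $\rho$ at each vertex is divided into consecutive intervals called (forward) buckets. A bucket of a vertex is processed only after the preceding (lower-$\rho$) bucket of the same vertex and after all buckets of predecessor vertices from which labels can be extended into it. Processing a bucket creates (pulls) its batch of labels by extending labels from those predecessor buckets across the in-edges of the vertex; each newly created label is tested for dominance and is then either stored at the vertex or discarded. *)

(* Defs.v *)
From HB Require Import structures.
From mathcomp Require Import all_boot all_order all_algebra.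

Set Implicit Arguments.
Unset Strict Implicit.
Unset Printing Implicit Defensive.

Import Order.TTheory GRing.Theory Num.Theory.

Local Open Scope ring_scope.

(* The resources are indexed by 'I_n.+1: ord0 is the monotone resource rho,
   and the index order is the fixed order of the remaining ones. *)
Definition state (F : realDomainType) (n : nat) := 'I_n.+1 -> F.

(* [ref u w r x] is the value of resource [r] after crossing (u, w) from the
   resource state [x]; it may depend on the whole state.  Lower ends of resource
   windows, if any, are part of [ref] (waiting), so that feasibility of a state
   at a vertex amounts to the upper limits. *)
Record rcspp (F : realDomainType) (n : nat) := RCSPP {
  vertex : finType;
  edge : rel vertex;
  source : vertex;
  target : vertex;
  edge_cost : vertex -> vertex -> F;
  ref : vertex -> vertex -> 'I_n.+1 -> state F n -> F;
  limit : vertex -> 'I_n.+1 -> F;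
  start : state F n
}.

Section Defs.

Variables (F : realDomainType) (n : nat) (P : rcspp F n).

Local Notation V := (vertex P).

Definition refs_nondecreasing :=
  forall (u w : V) (r : 'I_n.+1) (x y : state F n),
    edge u w -> (forall q, x q <= y q) -> ref u w r x <= ref u w r y.

Definition rho_strictly_increasing :=
  forall (u w : V) (x : state F n), edge u w -> x ord0 < ref u w ord0 x.

(* Partial paths issued from a vertex [u] are given by the sequence of the
   vertices visited after [u]. *)

Fixpoint walk_cost (u : V) (p : seq V) : F :=
  if p is w :: p' then edge_cost u w + walk_cost w p' else 0.

Fixpoint walk_state (x : state F n) (u : V) (p : seq V) : state F n :=
  if p is w :: p' then walk_state ((ref u w)^~ x) w p' else x.

Definition within (u : V) (x : state F n) := [forall r, x r <= limit u r].

Fixpoint walk_feasible (x : state F n) (u : V) (p : seq V) : bool :=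
  if p is w :: p' then
    let y := (ref u w)^~ x in
    [&& edge u w, within w y & walk_feasible y w p']
  else true.

(* A label is identified with its partial path from the source. *)
Definition label := seq V.

Implicit Types (L : label) (c S : seq label).

Definition endpoint L : V := last (source P) L.
Definition cost L : F := walk_cost (source P) L.
Definition res L : state F n := walk_state (start P) (source P) L.
Definition rho L : F := res L ord0.
Definition is_label L : bool :=
  within (source P) (start P) && walk_feasible (start P) (source P) L.

Definition extension L (eps : seq V) : bool :=
  walk_feasible (res L) (endpoint L) eps
  && (last (endpoint L) eps == target P).

Definition dominates L1 L2 : Prop :=
  endpoint L1 = endpoint L2 /\
  forall eps, extension L2 eps ->
    extension L1 eps /\ cost (L1 ++ eps) <= cost (L2 ++ eps).

(* The sufficient condition by which the algorithm decides dominance. *)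
Definition dom_test L1 L2 : bool :=
  [&& endpoint L1 == endpoint L2, cost L1 <= cost L2
    & [forall r, res L1 r <= res L2 r]].

Definition duplicate L1 L2 : bool :=
  [&& endpoint L1 == endpoint L2, cost L1 == cost L2
    & [forall r, res L1 r == res L2 r]].

Definition lex_key L : seqlexi F :=
  [:: rho L, cost L & [seq res L (lift ord0 i) | i <- enum 'I_n]].

Definition lex_le : rel label := fun L1 L2 => (lex_key L1 <= lex_key L2)%O.

Definition dominated_by S L : bool := has (fun M => dom_test M L) S.

(* Test-only insertion: a new label is compared with the stored ones and never
   displaces any of them. *)
Definition insert S L : seq label :=
  if dominated_by S L then S else rcons S L.

Definition store c : seq label := foldl insert [::] c.

(* Insertion with clean-up: a new label that passes the test also removes the
   stored labels it dominates. *)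
Definition insert_clean S L : seq label :=
  if dominated_by S L then S
  else rcons [seq M <- S | ~~ dom_test L M] L.

Definition store_clean c : seq label := foldl insert_clean [::] c.

(* [bk u x] is the index of the bucket of [u] that contains the value [x] of
   rho.  The fibres of a non-decreasing index map are consecutive intervals,
   with any convention on their end points. *)
Variable bk : V -> F -> nat.

Definition consecutive_buckets :=
  forall (u : V) (x y : F), x <= y -> (bk u x <= bk u y)%N.

Definition bucket := (V * nat)%type.

Definition in_bucket (b : bucket) L : bool :=
  [&& is_label L, endpoint L == b.1 & bk b.1 (rho L) == b.2].

Definition extends_into (b b' : bucket) : Prop :=
  exists2 L, in_bucket b L & in_bucket b' (rcons L b'.1).

(* [processed] lists the buckets already processed. *)
Definition may_process (processed : seq bucket) (b : bucket) : Prop :=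
  [/\ b \notin processed,
      (0 < b.2)%N -> (b.1, b.2.-1) \in processed
    & forall b', extends_into b' b -> b' \in processed].

(* A trace maps [u] to the sequence of all labels created at [u] so far, in
   order of creation, whether they were stored or discarded. *)
Definition trace := V -> seq label.

Definition init_trace : trace :=
  fun u => if (u == source P) && is_label [::] then [:: [::]] else [::].

(* The labels pulled into [b].  A stored label extending into [b] necessarily
   lies in a bucket related to [b] by [extends_into]. *)
Definition pulled (t : trace) (b : bucket) : seq label :=
  [seq M <- [seq rcons L b.1 | u <- enum V, L <- store (t u)] | in_bucket b M].

(* [run ok processed t]: the buckets [processed] have been processed in this
   order, each batch being inserted in some order satisfying [ok], and [t] is
   the resulting trace. *)
Inductive run (ok : pred (seq label)) : seq bucket -> trace -> Prop :=
| run_init : run ok [::] init_trace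
| run_process (processed : seq bucket) (t : trace) (b : bucket)
    (batch : seq label) of
    run ok processed t & may_process processed b
    & perm_eq batch (pulled t b) & ok batch :
    run ok (rcons processed b)
      (fun u => if u == b.1 then t u ++ batch else t u).

Definition pull_run := run (sorted lex_le).
Definition unsorted_run := run xpredT.

End Defs.

(* Main.v *)
Require Import Defs.
From HB Require Import structures.
From mathcomp Require Import all_boot all_order all_algebra.

Set Implicit Arguments.
Unset Strict Implicit.
Unset Printing Implicit Defensive.

Import Order.TTheory GRing.Theory Num.Theory.

Local Open Scope ring_scope.

(* Componentwise domination implies lexicographic precedence.  Hence if a label
   passes the dominance test against a lexicographically smaller or equal one,
   the two are equal in every coordinate by antisymmetry, and the later of them
   is rejected as a duplicate.  Batches of one vertex are ordered because its
   buckets are processed in increasing order and the index map is monotone; the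
   empty path, created before any bucket of the source, has least rho there. *)

(** * Partial paths: concatenation, feasibility and growth of [rho] *)

Section Walks.

Variables (F : realDomainType) (n : nat) (P : rcspp F n).
Implicit Types (u w : vertex P) (p q : seq (vertex P)) (x y : state F n).

Lemma walk_cost_cat u p q :
  walk_cost u (p ++ q) = walk_cost u p + walk_cost (last u p) q.
Proof.
by elim: p u => [|w p IHp] u /=; rewrite ?add0r // IHp addrA.
Qed.

Lemma walk_feasible_cat x u p q :
  walk_feasible x u (p ++ q) =
  walk_feasible x u p && walk_feasible (walk_state x u p) (last u p) q.
Proof. by elim: p x u => [|w p IHp] x u //=; rewrite IHp !andbA. Qed.

(** Windows impose upper limits only, and monotone extension functions keep the smaller state
    smaller after each edge. *)
Lemma walk_feasible_le x y u p : refs_nondecreasing P ->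
  (forall r, x r <= y r) -> walk_feasible y u p -> walk_feasible x u p.
Proof.
move=> ref_homo; elim: p x y u => [|w p IHp] x y u //= le_xy.
case/and3P=> e_uw /forallP in_w feas_p.
have le_ref r : ref u w r x <= ref u w r y by apply: ref_homo.
rewrite e_uw (IHp _ _ w le_ref feas_p) andbT.
by apply/forallP=> r; apply: le_trans (in_w r).
Qed.

Lemma walk_rho_ge x u p : rho_strictly_increasing P ->
  walk_feasible x u p -> x ord0 <= walk_state x u p ord0.
Proof.
move=> rho_incr; elim: p x u => [|w p IHp] x u //= /and3P[e_uw _ /IHp].
exact/le_trans/ltW/rho_incr.
Qed.

(** The first edge raises [rho] strictly and the remaining ones never lower it. *)
Lemma rho_nil_lt u (L : label P) : rho_strictly_increasing P ->
  is_label (rcons L u) -> rho ([::] : label P) < rho (rcons L u).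
Proof.
move=> rho_incr /andP[_]; rewrite /rho /res.
case: L => [|w L] /= /and3P[e_w _ feas]; first exact: rho_incr.
by apply: lt_le_trans (walk_rho_ge rho_incr feas); apply: rho_incr.
Qed.

End Walks.

Lemma seqlexi_map_le (F : realDomainType) (I : Type) (f g : I -> F) (s : seq I) :
  (forall i, f i <= g i) -> ((map f s : seqlexi F) <= map g s)%O.
Proof.
move=> le_fg; elim: s => [|i s IHs] //=.
by rewrite Order.SeqLexiOrder.Exports.lexi_cons le_fg IHs implybT.
Qed.

(** * The dominance test and the lexicographic order *)

Section Dominance.

Variables (F : realDomainType) (n : nat) (P : rcspp F n).
Implicit Types (L M : label P) (c S : seq (label P)).

Lemma dom_test_refl L : dom_test L L.
Proof. by rewrite /dom_test eqxx lexx; apply/forallP. Qed.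

Lemma dom_test_trans : transitive (@dom_test F n P).
Proof.
move=> M L N /and3P[/eqP vLM cLM /forallP rLM] /and3P[/eqP vMN cMN /forallP rMN].
apply/and3P; split; first by rewrite vLM vMN.
  exact: le_trans cLM cMN.
by apply/forallP=> r; apply: le_trans (rLM r) (rMN r).
Qed.

Lemma duplicate_dom_test L M : duplicate L M -> dom_test M L.
Proof.
case/and3P=> /eqP vLM /eqP cLM /forallP rLM.
rewrite /dom_test vLM cLM eqxx lexx; apply/forallP=> r.
by rewrite (eqP (rLM r)).
Qed.

(** Soundness of the test: a common extension adds the same cost to both labels, and a smaller
    resource state keeps it feasible. *)
Lemma dom_test_dominates L M :
  refs_nondecreasing P -> dom_test L M -> dominates L M.
Proof.
move=> ref_homo /and3P[/eqP vLM cLM /forallP rLM]; split=> // eps.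
rewrite /extension /cost !walk_cost_cat -!/(endpoint _) -!/(cost _) vLM.
case/andP=> feas ->; rewrite andbT lerD2r; split=> //.
exact: walk_feasible_le feas.
Qed.

Lemma dom_test_lex_le L M : dom_test L M -> lex_le L M.
Proof.
case/and3P=> _ cLM /forallP rLM; rewrite /lex_le /lex_key.
rewrite !Order.SeqLexiOrder.Exports.lexi_cons rLM cLM.
by rewrite seqlexi_map_le ?implybT.
Qed.

Lemma lex_le_trans : transitive (@lex_le F n P).
Proof. by move=> M L N; apply: le_trans. Qed.

Lemma rho_lt_lex_le L M : rho L < rho M -> lex_le L M.
Proof.
move=> lt_LM; rewrite /lex_le /lex_key Order.SeqLexiOrder.Exports.lexi_cons.
by rewrite ltW // leNgt lt_LM.
Qed.

Lemma lex_le_dom_test_duplicate L M :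
  lex_le L M -> dom_test M L -> duplicate M L.
Proof.
move=> le_LM domML; have le_ML := dom_test_lex_le domML.
have /and3P[/eqP vML _ _] := domML.
have [eq_rho eq_cost eq_res]: lex_key M = lex_key L.
  by apply: le_anti; apply/andP.
rewrite /duplicate vML eq_cost !eqxx; apply/forallP=> r.
(* The key lists [rho] apart from the lifted indices, so the two cases of [unliftP] cover every
   resource. *)
have [i ->|->] := unliftP ord0 r; last exact/eqP.
by apply/eqP; move/eq_in_map: eq_res => -> //; rewrite mem_enum.
Qed.

End Dominance.

(** * Stores built by test-only insertion *)

Section Store.

Variables (F : realDomainType) (n : nat) (P : rcspp F n).
Implicit Types (L M : label P) (c S : seq (label P)).

Lemma store_rcons c L : store (rcons c L) = insert (store c) L.
Proof. exact: foldl_rcons. Qed.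

Lemma store_clean_rcons c L :
  store_clean (rcons c L) = insert_clean (store_clean c) L.
Proof. exact: foldl_rcons. Qed.

Lemma sub_insert S L : {subset S <= insert S L}.
Proof.
by rewrite /insert => M SM; case: ifP; rewrite // mem_rcons inE SM orbT.
Qed.

Lemma dominated_by_insert S L : dominated_by (insert S L) L.
Proof.
rewrite /insert; case: ifP => // _; apply/hasP; exists L; last exact: dom_test_refl.
by rewrite mem_rcons mem_head.
Qed.

Lemma store_sub c : {subset store c <= c}.
Proof.
elim/last_ind: c => // c L IHc M; rewrite store_rcons /insert (mem_rcons c) inE.
case: ifP => _; first by move=> /IHc->; rewrite orbT.
by rewrite mem_rcons inE => /predU1P[->|/IHc->]; rewrite ?eqxx ?orbT.
Qed.

Lemma sub_store_cat c1 c2 : {subset store c1 <= store (c1 ++ c2)}.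
Proof.
elim/last_ind: c2 => [|c L IHc] M c1M; first by rewrite cats0.
by rewrite -rcons_cat store_rcons; apply/sub_insert/IHc.
Qed.

(** A stored label passes the test against itself, a rejected one has a stored dominator, and later
    insertions remove neither. *)
Lemma mem_dominated_by_store c L : L \in c -> dominated_by (store c) L.
Proof.
elim/last_ind: c => // c M IHc; rewrite mem_rcons inE store_rcons.
have [-> _|_ /= /IHc/hasP[N cN domNL]] := eqVneq L M.
  exact: dominated_by_insert.
by apply/hasP; exists N; rewrite ?sub_insert.
Qed.

Lemma mem_store_nth c i k : (i < k)%N -> (i < size c)%N ->
  ~~ dominated_by (store (take i c)) (nth [::] c i) ->
  nth [::] c i \in store (take k c).
Proof.
move=> lt_ik lt_ic ndom; rewrite -(cat_take_drop i.+1 (take k c)).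
apply: sub_store_cat; rewrite take_takel // (take_nth [::]) //.
by rewrite store_rcons /insert (negPf ndom) mem_rcons mem_head.
Qed.

Lemma lex_sorted_nth c i k : sorted (@lex_le F n P) c ->
  (i < k < size c)%N -> lex_le (nth [::] c i) (nth [::] c k).
Proof.
move=> c_sorted /andP[lt_ik lt_kc].
by apply: (sorted_ltn_nth (@lex_le_trans _ _ P)); rewrite // inE (ltn_trans lt_ik).
Qed.

Lemma dominated_when_createdP c i : sorted (@lex_le F n P) c -> (i < size c)%N ->
  (dominated_by (store (take i c)) (nth [::] c i) <->
   exists k : nat,
     [/\ (k < size c)%N, k != i, dom_test (nth [::] c k) (nth [::] c i)
       & (k < i)%N || ~~ duplicate (nth [::] c k) (nth [::] c i)]).
Proof.
move=> c_sorted lt_ic; split=> [/hasP[M /store_sub]|[k [lt_kc neq_ki dom_ki]]].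
  case/(nthP [::])=> k; rewrite size_takel ?(ltnW lt_ic) // => lt_ki.
  by rewrite nth_take // => <- dom_ki; exists k; rewrite neq_ltn lt_ki (ltn_trans lt_ki).
have [lt_ki _|le_ik] /= := ltnP k i; last first.
  rewrite lex_le_dom_test_duplicate // lex_sorted_nth // lt_kc.
  by rewrite ltn_neqAle eq_sym neq_ki le_ik.
(* Label [k] may itself have been rejected; a stored label dominating it then takes its place by
   transitivity. *)
have /mem_dominated_by_store/hasP[M cM domMk]: nth [::] c k \in take i c.
  by rewrite -(nth_take [::] lt_ki) mem_nth // size_takel // ltnW.
by apply/hasP; exists M => //; apply: dom_test_trans dom_ki.
Qed.

Lemma lex_sorted_rcons c L : sorted (@lex_le F n P) (rcons c L) ->
  sorted (@lex_le F n P) c /\ {in store c, forall M, lex_le M L}.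
Proof.
rewrite !(sorted_pairwise (@lex_le_trans _ _ P)) pairwise_rcons.
by case/andP=> /allP leL ->; split=> // M /store_sub/leL.
Qed.

(** If [L] dominated an older [M], the two would be duplicates, so [M] would already have rejected
    [L]. *)
Lemma stored_not_dominated c L M : {in store c, forall N, lex_le N L} ->
  ~~ dominated_by (store c) L -> M \in store c ->
  ~~ dom_test M L && ~~ dom_test L M.
Proof.
move=> leL /hasPn ndom cM; rewrite ndom //=; apply: contra (ndom M cM) => domLM.
exact/duplicate_dom_test/lex_le_dom_test_duplicate/domLM/leL.
Qed.

Lemma pairwise_store c : sorted (@lex_le F n P) c ->
  pairwise (fun L M => ~~ dom_test L M && ~~ dom_test M L) (store c).
Proof.
elim/last_ind: c => // c L IHc /lex_sorted_rcons[/IHc pw leL].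
rewrite store_rcons /insert; case: ifPn => // ndom; rewrite pairwise_rcons pw andbT.
by apply/allP=> M; apply: stored_not_dominated.
Qed.

Lemma store_clean_store c : sorted (@lex_le F n P) c -> store_clean c = store c.
Proof.
elim/last_ind: c => // c L IHc /lex_sorted_rcons[/IHc eq_c leL].
rewrite store_clean_rcons store_rcons eq_c /insert_clean /insert.
case: ifPn => // ndom; congr rcons; apply/all_filterP/allP=> M.
by case/(stored_not_dominated leL ndom)/andP.
Qed.

End Store.

(** * Order of creation under the pull schedule *)

Section PullSchedule.

Variables (F : realDomainType) (n : nat) (P : rcspp F n).
Variable bk : vertex P -> F -> nat.
Implicit Types (u : vertex P) (L M : label P) (t : trace P).

Lemma mem_pulled t (b : bucket P) M : M \in pulled bk t b ->
  in_bucket bk b M /\ exists L, M = rcons L b.1.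
Proof.
rewrite mem_filter => /andP[-> /allpairsPdep[u [L [_ _ ->]]]].
by split=> //; exists L.
Qed.

(** Each bucket waits for the preceding one of its vertex, so the processed indices of a vertex form
    an initial segment. *)
Lemma run_processed_below ok processed t u j k : run bk ok processed t ->
  (j <= k)%N -> (u, k) \in processed -> (u, j) \in processed.
Proof.
move=> run_t; elim: run_t j k => // {processed t} procd t b batch _ IH [_ prev _] _ _ j k.
rewrite !mem_rcons !inE => le_jk.
case/predU1P=> [def_b|/(IH _ _ le_jk)->]; last exact: orbT.
move: prev; rewrite -def_b /= => prev.
case: k => [|k] in le_jk prev {def_b} *; first by case: j le_jk; rewrite ?eqxx.
by move: le_jk; rewrite leq_eqVlt => /predU1P[->|/(IH j k)->]; rewrite ?eqxx ?orbT ?prev.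
Qed.

Lemma run_labels ok processed t u : run bk ok processed t ->
  all (fun L => is_label L && (endpoint L == u)) (t u).
Proof.
elim=> {processed t} [|procd t b batch _ IH _ eq_batch _].
  by rewrite /init_trace; case: ifP => //= /andP[/eqP-> ->]; rewrite eqxx.
case: eqP => // def_u; rewrite all_cat IH; apply/allP=> M.
by rewrite (perm_mem eq_batch) def_u => /mem_pulled[/and3P[-> -> _] _].
Qed.

(** The empty path is the only label that can be present before any bucket is processed, hence the
    exception. *)
Lemma run_bucket_processed ok processed t u L : run bk ok processed t ->
  L \in t u -> L = [::] \/ (u, bk u (rho L)) \in processed.
Proof.
move=> run_t; elim: run_t L => {processed t} [|procd t b batch _ IH _ eq_batch _] L.
  by rewrite /init_trace; case: ifP; rewrite // inE => _ /eqP; left.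
rewrite mem_rcons inE; case: eqP => [def_u|_]; last first.
  by case/IH=> [->|->]; [left | right; rewrite orbT].
rewrite mem_cat; case/orP=> [/IH[->|->]|]; [by left | by right; rewrite orbT |].
rewrite (perm_mem eq_batch) => /mem_pulled[/and3P[_ _ /eqP def_k] _].
by right; rewrite def_u def_k -surjective_pairing eqxx.
Qed.

Lemma pull_run_sorted processed t u :
  rho_strictly_increasing P -> consecutive_buckets bk ->
  pull_run bk processed t -> sorted (@lex_le F n P) (t u).
Proof.
move=> rho_incr bk_homo; elim=> {processed t} [|procd t b batch run_t IH].
  by rewrite /init_trace; case: ifP.
case=> b_new _ _ eq_batch; case: eqP => // ->{u} in IH *.
rewrite !(sorted_pairwise (@lex_le_trans _ _ P)) pairwise_cat in IH * => ->.
rewrite IH !andbT; apply/allrelP=> L M tL.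
rewrite (perm_mem eq_batch) => /mem_pulled[/and3P[lab_M _ /eqP bkM] [M' def_M]].
apply: rho_lt_lex_le.
have [->|bkL_proc] := run_bucket_processed run_t tL.
  by rewrite def_M in lab_M *; apply: rho_nil_lt.
(* Otherwise the index of [b] is at most that of the processed bucket of [L], so [b] was already
   processed, against [b_new]. *)
rewrite ltNge; apply/negP=> /(bk_homo b.1); rewrite bkM => le_b_L.
case/negP: b_new; rewrite [b]surjective_pairing.
exact: run_processed_below run_t le_b_L bkL_proc.
Qed.

End PullSchedule.

(** * A counterexample without the per-batch sort *)

Section UnsortedBatch.

Variable F : realDomainType.

Let s : 'I_3 := ord0.
Let m : 'I_3 := lift ord0 ord0.
Let v : 'I_3 := lift ord0 (lift ord0 ord0).

(* The single resource counts edges, and costs are zero, so that the path s -> v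
   strictly dominates s -> m -> v; both fall into the only bucket of v. *)
Definition detour : rcspp F 0 :=
  @RCSPP F 0 'I_3 (fun u w : 'I_3 => (u < w)%N) s v (fun _ _ => 0)
    (fun _ _ r x => x r + 1) (fun _ _ => 2) (fun _ => 0).

Let bk (u : vertex detour) (x : F) : nat := 0.

Lemma detour_unsorted_run : exists2 t : trace detour,
  unsorted_run bk [:: (s, 0); (m, 0); (v, 0)]%N t & t v = [:: [:: m; v]; [:: v]].
Proof.
have in0 u : within (P := detour) u (fun=> 0) by apply/forallP=> r /=; rewrite ler0n.
have in1 u : within (P := detour) u (fun=> 0 + 1).
  by apply/forallP=> r /=; rewrite add0r ler1n.
have in2 u : within (P := detour) u (fun=> 0 + 1 + 1).
  by apply/forallP=> r /=; rewrite add0r lexx.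
(* Edges increase the vertex number, so processing [s], [m], [v] in turn respects all predecessor
   constraints. *)
have bucket_pred b b' : extends_into bk b b' -> b.2 = 0%N /\ (b.1 < b'.1)%N.
  case=> L /and3P[_ /eqP <- /eqP <-] /and3P[/andP[_]].
  by rewrite -cats1 walk_feasible_cat => /andP[_ /= /and3P[]].
have enumV : enum (vertex detour) = [:: s; m; v].
  by rewrite !enum_ordSl /= (size0nil (size_enum_ord 0)).
have lab0 : is_label ([::] : label detour) by rewrite /is_label /= in0.
have labs : ~~ is_label ([:: s] : label detour) by rewrite /is_label /= andbF.
have labm : is_label ([:: m] : label detour) by rewrite /is_label /= in0 in1.
have labv : is_label ([:: v] : label detour) by rewrite /is_label /= in0 in1.
have labmv : is_label ([:: m; v] : label detour).
  by rewrite /is_label /= in0 in1 in2.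
have run_nil := run_init bk xpredT.
have may_s : may_process bk [::] (s, 0%N) by split=> // b /bucket_pred[].
have batch_s : perm_eq [::] (pulled bk (init_trace (P := detour)) (s, 0%N)).
  rewrite /pulled enumV /init_trace /= lab0 /= /in_bucket.
  by rewrite (negPf labs).
have {run_nil may_s batch_s} run_s := run_process run_nil may_s batch_s isT.
have may_m : may_process bk [:: (s, 0)]%N (m, 0%N).
  split=> // [[u k]] /bucket_pred[/= -> lt_um].
  by rewrite inE; case: u lt_um => [[|[]]].
move: run_s; set t_s := (X in run _ _ _ X) => run_s.
have batch_m : perm_eq [:: [:: m]] (pulled bk t_s (m, 0%N)).
  by rewrite /pulled enumV /t_s /init_trace /= lab0 /= /in_bucket /= labm.
have {run_s may_m batch_m} run_m := run_process run_s may_m batch_m isT.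
have may_v : may_process bk [:: (s, 0); (m, 0)]%N (v, 0%N).
  split=> // [[u k]] /bucket_pred[/= -> lt_uv].
  by rewrite !inE; case: u lt_uv => [[|[|[]]]].
move: run_m; set t_m := (X in run _ _ _ X) => run_m.
have batch_v : perm_eq [:: [:: m; v]; [:: v]] (pulled bk t_m (v, 0%N)).
  rewrite /pulled enumV /t_m /t_s /init_trace /= lab0 /= /in_bucket /= labv labmv.
  (* The enumeration pulls [[:: v]] first; an unsorted batch may place it after the detour. *)
  by rewrite (perm_catC [:: _] [:: _]).
by eexists; first exact: (run_process run_m may_v batch_v isT).
Qed.

Lemma unsorted_batch_dominated :
  exists (n : nat) (P : rcspp F n) (bk : vertex P -> F -> nat)
          (processed : seq (bucket P)) (t : trace P) (b : bucket P) (L M : label P),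
     [/\ refs_nondecreasing P, rho_strictly_increasing P,
         consecutive_buckets bk & unsorted_run bk processed t]
     /\ [/\ in_bucket bk b L, in_bucket bk b M,
            L \in store (t b.1), M \in store (t b.1)
          & dom_test M L && ~~ duplicate M L].
Proof.
have [t run_t t_v] := detour_unsorted_run.
have := run_labels (v : vertex detour) run_t; rewrite t_v /= andbT => /andP[lab_mv lab_v].
have dom_v : dom_test ([:: v] : label detour) [:: m; v].
  rewrite /dom_test /cost /= !addr0 lexx; apply/forallP=> r.
  by rewrite /res /= lerDl ler01.
have ndom_mv : ~~ dom_test ([:: m; v] : label detour) [:: v].
  apply/negP=> /and3P[_ _ /forallP/(_ ord0)].
  by rewrite /res /= gerDl ler10.
(* The detour is inserted first and does not dominate the direct path, so both are stored. *)
have store_v : store (t v) = [:: [:: m; v]; [:: v]].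
  by rewrite t_v /store /= /insert /= orbF (negPf ndom_mv).
exists 0%N, detour, bk, [:: (s, 0); (m, 0); (v, 0)]%N, t, (v, 0%N).
exists [:: m; v], [:: v]; split.
  split=> // [u w r x y _ le_xy | u w x _].
    by rewrite lerD2r.
  by rewrite ltrDl ltr01.
rewrite /in_bucket /= store_v !inE !eqxx orbT dom_v !andbT.
split; rewrite ?(andP lab_v).1 ?(andP lab_mv).1 //=.
by apply: contra ndom_mv; apply: duplicate_dom_test.
Qed.

End UnsortedBatch.

Theorem lemma4 (F : realDomainType) :
  (forall (n : nat) (P : rcspp F n) (v : vertex P),
     refs_nondecreasing P -> rho_strictly_increasing P ->
     (* the pull schedule creates the labels of v in lexicographic order *)
     (forall (bk : vertex P -> F -> nat) (processed : seq (bucket P)) (t : trace P),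
        consecutive_buckets bk -> pull_run bk processed t ->
        all (fun L => is_label L && (endpoint L == v)) (t v)
        /\ sorted (@lex_le F n P) (t v))
     /\
     (forall c : seq (label P),
        all (fun L => is_label L && (endpoint L == v)) c ->
        sorted (@lex_le F n P) c ->
        [/\ (* a label not dominated when created is never dominated by a later
               one, except for duplicates, which are discarded on creation *)
            forall i k : nat, (i < k < size c)%N ->
              ~~ dominated_by (store (take i c)) (nth [::] c i) ->
              dom_test (nth [::] c k) (nth [::] c i) ->
              duplicate (nth [::] c k) (nth [::] c i)
              /\ dominated_by (store (take k c)) (nth [::] c k),
            (* testing against the stored labels detects all dominance among
               the labels ever created *)
            forall i : nat, (i < size c)%N ->
              (dominated_by (store (take i c)) (nth [::] c i) <->
               exists k : nat,
                 [/\ (k < size c)%N, k != i,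
                     dom_test (nth [::] c k) (nth [::] c i)
                   & (k < i)%N || ~~ duplicate (nth [::] c k) (nth [::] c i)]),
            (* every created label is dominated by a stored one *)
            forall L, L \in c ->
              exists2 M, M \in store c & dom_test M L /\ dominates M L,
            (* no stored label is dominated by another stored label *)
            pairwise (fun L M => ~~ dom_test L M && ~~ dom_test M L) (store c)
          & (* a stored label is never removed *)
            store_clean c = store c]))
  /\
  (* without the per-batch sort, a label may be stored although another label
     of the same batch dominates it *)
  (exists (n : nat) (P : rcspp F n) (bk : vertex P -> F -> nat)
          (processed : seq (bucket P)) (t : trace P) (b : bucket P) (L M : label P),
     [/\ refs_nondecreasing P, rho_strictly_increasing P,
         consecutive_buckets bk & unsorted_run bk processed t]
     /\ [/\ in_bucket bk b L, in_bucket bk b M,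
            L \in store (t b.1), M \in store (t b.1)
          & dom_test M L && ~~ duplicate M L]).
Proof.
split=> [n P v ref_homo rho_incr|].
  split=> [bk processed t bk_homo run_t|c c_labels c_sorted].
    by split; [apply: run_labels run_t | apply: pull_run_sorted run_t].
  split.
  - move=> i k lt_ikc ndom dom_ki; have [lt_ik lt_kc] := andP lt_ikc.
    have dup := lex_le_dom_test_duplicate (lex_sorted_nth c_sorted lt_ikc) dom_ki.
    (* Label [i], stored at its creation, is still there when label [k] arrives and rejects it as a
       duplicate. *)
    split=> //; apply/hasP; exists (nth [::] c i); last exact: duplicate_dom_test.
    by apply: mem_store_nth => //; apply: ltn_trans lt_kc.
  - by move=> i; apply: dominated_when_createdP.
  - move=> L /mem_dominated_by_store/hasP[M cM domML].
    by exists M => //; split=> //; apply: dom_test_dominates.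
  - exact: pairwise_store.
  - exact: store_clean_store.
exact: unsorted_batch_dominated.
Qed.
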